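(* Let $S$ be a monoid satisfying the following conditions: (i) there is $N$ such that for each $n\ge N$, $S$ satisfies the identity $x_1x_2\cdots x_n\,y_1y_2\cdots y_n\,x_n\cdots x_2x_1\,y_n\cdots y_2y_1\approx y_1\cdots y_n\,x_1\cdots x_n\,y_n\cdots y_1\,x_n\cdots x_1$; (ii) for all integers $m,c\ge0$ with $m+c>0$ and every identity $x^mtx^c\approx\mathbf v$ satisfied by $S$ (with $x\neq t$ variables), the set $\{{}_{1}x,\,t\}$ of occurrences in $x^mtx^c$ (the first occurrence of $x$ and the occurrence of $t$) is $l_{x^mtx^c,\mathbf v}$-stable in $x^mtx^c\approx\mathbf v$; (iii) for all $m,c>1$, every word $\mathbf w$ such that $S$ satisfies $x^my^c\approx\mathbf w$ is of the form $x^iy^j$ for some $i,j>1$; (iv) for all $m,c>0$ and $d>1$, every word $\mathbf w$ such that $S$ satisfies $x^my^dx^c\approx\mathbf w$ is of the form $x^iy^jx^k$ for some $i,k>0$ and $j>1$. Then $S$ is non-finitely based.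
   Context: Variables are letters of a countably infinite alphabet $\mathfrak A$, words are elements of the free semigroup $\mathfrak A^+$; a monoid $S$ satisfies $\mathbf u\approx\mathbf v$ if $\varphi(\mathbf u)=\varphi(\mathbf v)$ for all homomorphisms $\varphi:\mathfrak A^+\to S$. $S$ is finitely based if all its identities are derivable from a finite subset of them; otherwise non-finitely based. For a word $\mathbf u$: $\mathrm{occ}_{\mathbf u}(x)$ is the number of occurrences of $x$; ${}_{i\mathbf u}x$ is the $i$-th occurrence of $x$ in $\mathbf u$; $\mathrm{ocs}(\mathbf u)$ is the set of all occurrences of variables in $\mathbf u$, totally ordered by position ($<_{\mathbf u}$). For words $\mathbf u,\mathbf v$ sharing a variable, $l_{\mathbf u,\mathbf v}$ is the map from $\{{}_{i\mathbf u}x: i\le\min(\mathrm{occ}_{\mathbf u}(x),\mathrm{occ}_{\mathbf v}(x))\}$ to $\mathrm{ocs}(\mathbf v)$ given by ${}_{i\mathbf u}x\mapsto{}_{i\mathbf v}x$. A set $X\subseteq\mathrm{ocs}(\mathbf u)$ is $l_{\mathbf u,\mathbf v}$-stable in $\mathbf u\approx\mathbf v$ if $l_{\mathbf u,\mathbf v}$ is defined on $X$ and is an order isomorphism from $(X,<_{\mathbf u})$ onto $(l_{\mathbf u,\mathbf v}(X),<_{\mathbf v})$. *)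

(* Defs.v *)
From mathcomp Require Import all_boot.
Set Implicit Arguments. Unset Strict Implicit. Unset Printing Implicit Defensive.

Record monoid := Monoid {
  carrier :> Type;
  mul : carrier -> carrier -> carrier;
  one : carrier;
  mulA : forall a b c, mul a (mul b c) = mul (mul a b) c;
  mul1 : forall a, mul one a = a;
  mul1' : forall a, mul a one = a }.

(* Variables are natural numbers (a countably infinite alphabet);
   words are sequences of variables; elements of A^+ are the non-empty ones. *)
Definition word := seq nat.

Definition eval (S : monoid) (f : nat -> S) (u : word) : S :=
  foldr (fun x acc => mul (f x) acc) (one S) u.

Definition satisfies (S : monoid) (u v : word) : Prop :=
  forall f : nat -> S, eval f u = eval f v.

Definition subst (sigma : nat -> word) (u : word) : word := flatten (map sigma u).

Inductive derivable (Sigma : seq (word * word)) : word -> word -> Prop :=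
| der_refl u : derivable Sigma u u
| der_sym u v : derivable Sigma u v -> derivable Sigma v u
| der_trans u v w : derivable Sigma u v -> derivable Sigma v w -> derivable Sigma u w
| der_step (s t : word) (sigma : nat -> word) (a b : word) :
    (s, t) \in Sigma -> (forall x, sigma x != [::]) ->
    derivable Sigma (a ++ subst sigma s ++ b) (a ++ subst sigma t ++ b).

Definition finitely_based (S : monoid) : Prop :=
  exists Sigma : seq (word * word),
    (forall p, p \in Sigma -> [/\ p.1 != [::], p.2 != [::] & satisfies S p.1 p.2]) /\
    (forall u v : word, u != [::] -> v != [::] -> satisfies S u v -> derivable Sigma u v).

Definition non_finitely_based (S : monoid) : Prop := ~ finitely_based S.

(* Occurrences: the pair (x, i) denotes the i-th occurrence  _{i}x  of x. *)
Definition occ (u : word) (x : nat) : nat := count_mem x u.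

Definition is_occ (u : word) (o : nat * nat) : bool := (0 < o.2 <= occ u o.1).

Definition pos (u : word) (o : nat * nat) : nat :=
  find (fun k => (nth 0 u k == o.1) && (count_mem o.1 (take k.+1 u) == o.2))
       (iota 0 (size u)).

(* X (a finite set of occurrences, given as a list) is l_{u,v}-stable in u ~ v:
   X is a set of occurrences of u on which l_{u,v} : _{iu}x |-> _{iv}x is defined
   (i <= min(occ_u x, occ_v x)), and l_{u,v} is an order isomorphism
   (X, <_u) -> (l_{u,v}(X), <_v). *)
Definition stable (u v : word) (X : seq (nat * nat)) : Prop :=
  (forall o, o \in X -> is_occ u o && is_occ v o) /\
  (forall a b, a \in X -> b \in X -> (pos u a < pos u b) = (pos v a < pos v b)).

(* Words of condition (i): x_i := i, y_i := n + i  (1 <= i <= n). *)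
Definition xs (n : nat) : word := iota 1 n.
Definition ys (n : nat) : word := iota n.+1 n.
Definition lhs_i (n : nat) : word := xs n ++ ys n ++ rev (xs n) ++ rev (ys n).
Definition rhs_i (n : nat) : word := ys n ++ xs n ++ rev (ys n) ++ rev (xs n).

(* Main.v *)
Require Import Defs.
From mathcomp Require Import all_boot.
From mathcomp Require Import zify.
Set Implicit Arguments. Unset Strict Implicit. Unset Printing Implicit Defensive.

(* Let w be a word equal in S to the left side L of (i). By (iv), w restricted to two
   letters x_i, x_j (i < j) is x_i^a x_j^b x_i^c (a "sandwich"), likewise for the y's,
   while no x_i, y_j form a sandwich. Hence, for indices at least 2, either every x
   starts before every y or every y starts before every x; the former happens for L and
   the latter for the right side of (i).
   An identity of S whose sides are shorter than n - 1 cannot switch from one kind to the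
   other: two of the letters x_2, ..., x_n must start in the image of one variable t,
   which the sandwich form forces to be linear, and by (ii) the first occurrence of t
   keeps its position relative to the first occurrences of all other variables. *)

(** * Subsequences, first occurrences and restrictions of words *)

Lemma subseq_split (T : eqType) (s1 s2 w : seq T) :
  subseq (s1 ++ s2) w ->
  exists p r, [/\ w = p ++ r, subseq s1 p & subseq s2 r].
Proof.
elim: w s1 => [|z w IHw] [|x s1] /=.
- by move=> s20; exists [::], [::].
- by [].
- by move=> s2w; exists [::], (z :: w).
case: eqP => [->|/eqP xz] sub.
  have [p [r [-> s1p s2r]]] := IHw _ sub.
  by exists (z :: p), r; split => //=; rewrite eqxx.
have [p [r [-> s1p s2r]]] := IHw (x :: s1) sub.
by exists (z :: p), r; split => //=; rewrite (negbTE xz).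
Qed.

Lemma subseq_pair (T : eqType) (x y : T) (w : seq T) :
  x \in w -> y \in w -> x != y -> subseq [:: x; y] w || subseq [:: y; x] w.
Proof.
elim: w => // z w IHw; rewrite !inE.
case/orP=> [/eqP <-|xw]; case/orP => [/eqP <-|yw] xy.
- by rewrite eqxx in xy.
- by rewrite /= eqxx sub1seq yw.
- by rewrite /= eqxx sub1seq xw orbT.
by case/orP: (IHw xw yw xy) => sub; apply/orP; [left|right];
  apply: subseq_trans sub (subseq_cons _ _).
Qed.

Lemma count_eq1 (T : eqType) (x : T) (w : seq T) :
  count_mem x w = 1 -> exists p r, [/\ w = p ++ x :: r, x \notin p & x \notin r].
Proof.
move=> cx; have xw: x \in w by rewrite -has_pred1 has_count cx.
case/splitPr: xw cx => p r; rewrite count_cat /= eqxx => cx.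
exists p, r; split=> //; rewrite -has_pred1 has_count; apply/negP => c0.
  by move: cx c0; rewrite addnCA add1n => -[]; case: (count_mem x p).
by move: cx c0; rewrite addnCA add1n => -[]; case: (count_mem x p); case: (count_mem x r).
Qed.

Lemma index_split (T : eqType) (x : T) (w : seq T) :
  x \in w -> exists p r, w = p ++ x :: r /\ x \notin p.
Proof.
move=> xw; exists (take (index x w) w), (drop (index x w).+1 w).
by rewrite -drop_index // cat_take_drop in_take ?ltnn.
Qed.

(** A letter absent from a word has [index] equal to the length, so it counts as starting after
    every letter present. *)
Lemma index_lt_cat (T : eqType) (p r : seq T) (x y : T) : x \in p ->
  (index x (p ++ r) < index y (p ++ r)) = (index x p < index y p).
Proof.
move=> xp; rewrite !index_cat xp; case: ifP => // /negbT yp.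
have xs: index x p < size p by rewrite index_mem.
by rewrite ltn_addr // (memNindex yp) xs.
Qed.

Lemma index_lt_cat_notin (T : eqType) (p r : seq T) (x y : T) : x \notin p ->
  (index x (p ++ r) < index y (p ++ r)) = (y \notin p) && (index x r < index y r).
Proof.
move=> xp; rewrite !index_cat (negbTE xp); case: ifP => /= yp; last by rewrite ltn_add2l.
by apply/negbTE; rewrite -leqNgt (leq_trans (ltnW _) (leq_addr _ _)) // index_mem.
Qed.

Lemma index_lt_filter (T : eqType) (P : pred T) (w : seq T) (x y : T) : P x -> P y ->
  (index x (filter P w) < index y (filter P w)) = (index x w < index y w).
Proof.
move=> Px Py; elim: w => //= z w IHw.
case: (boolP (P z)) => Pz /=.
  by case: (z == x); case: (z == y).
have /negbTE->: z != x by apply: contraNneq Pz => ->.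
by have /negbTE->: z != y by apply: contraNneq Pz => ->.
Qed.

Lemma filter_pred2_nseq (T : eqType) (x y : T) (w : seq T) : y \notin w ->
  filter (pred2 x y) w = nseq (count_mem x w) x.
Proof.
move=> yw; rewrite -size_filter; have -> : filter (pred2 x y) w = filter (pred1 x) w.
  apply: eq_in_filter => z zw /=; case: (z =P y) zw => [->|_]; last by rewrite orbF.
  by rewrite (negbTE yw).
by apply/all_pred1P/filter_all.
Qed.

(** * Combinatorics of sandwiches *)

Definition sandwich (x y : nat) (w : word) : Prop :=
  exists a b c, [/\ x != y, 0 < a, 1 < b, 0 < c &
    filter (pred2 x y) w = nseq a x ++ nseq b y ++ nseq c x].

Lemma sandwich_subseq x y w : sandwich x y w -> ~ subseq [:: y; x; y] w.
Proof.
move=> [a [b [c [xy _ _ _ e]]]] sub.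
have: subseq [:: y; x; y] (filter (pred2 x y) w).
  by rewrite subseq_filter sub /= !eqxx !orbT.
rewrite e; elim: a {e} => [|a IHa] /=; last by rewrite eq_sym (negbTE xy).
case: b => [|b] /=.
  by move/mem_subseq/(_ y); rewrite inE eqxx mem_nseq eq_sym (negbTE xy) andbF => /(_ isT).
rewrite eqxx; elim: b => [|b IHb] /=; last by rewrite (negbTE xy).
move/mem_subseq/(_ y); rewrite !inE eqxx orbT mem_nseq eq_sym (negbTE xy) andbF.
by move=> /(_ isT).
Qed.

Lemma sandwich_split x y p r : sandwich x y (p ++ y :: r) -> x \in p /\ x \in r.
Proof.
move=> [a [b [c [xy a0 _ c0]]]]; rewrite filter_cat /= eqxx orbT => e.
split.
  (* Without [x] in [p] the restricted word would begin with [y], while the sandwich begins with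
     [x]. For [r] the last letters are compared. *)
  apply/negPn/negP => xp; move: e; rewrite (eq_filter (a2 := pred2 y x)); last first.
    by move=> z /=; rewrite orbC.
  rewrite filter_pred2_nseq //; case: a a0 => // a _.
  by case: (count_mem y p) => [|k] /= [] e _; rewrite e eqxx in xy.
apply/negPn/negP => xr; move: e; rewrite [in X in _ ++ _ :: X](eq_filter (a2 := pred2 y x)); last first.
  by move=> z /=; rewrite orbC.
rewrite filter_pred2_nseq // => /(congr1 (last y)).
rewrite !last_cat /=; case: c c0 => // c _ /=.
have last_nseq z k : last z (nseq k z) = z by elim: k.
by rewrite !last_nseq => e; rewrite e eqxx in xy.
Qed.

Lemma sandwich_mem x y w : sandwich x y w -> x \in w /\ y \in w.
Proof.
move=> [a [b [c [xy a0 b0 _ e]]]].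
have s: {subset filter (pred2 x y) w <= w} by apply: mem_subseq (filter_subseq _ _).
by split; apply: s; rewrite e !mem_cat !mem_nseq eqxx ?a0 ?(ltnW b0) ?orbT.
Qed.

Lemma sandwich_count x y w : sandwich x y w -> 1 < count_mem y w.
Proof.
move=> [a [b [c [xy a0 b0 _ e]]]].
have -> : count_mem y w = count_mem y (filter (pred2 x y) w).
  rewrite count_filter; apply: eq_count => z /=.
  by case: (z == y); rewrite ?orbT.
by rewrite e !count_cat !count_nseq /= eqxx mul1n ltn_addl // ltn_addr.
Qed.

(** If [a] encloses [b], some [a] follows this [b], which yields [a x a]; if [b] encloses [a], some
    [b] precedes this [a], which yields [b x b]. Neither fits inside a sandwich with outer letter
    [x]. *)
Lemma sandwich_subseq3 x a b w : sandwich x a w -> sandwich x b w ->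
  [\/ a = b, sandwich a b w | sandwich b a w] -> ~ subseq [:: a; x; b] w.
Proof.
move=> xa xb [<-|ab|ba]; first exact: sandwich_subseq.
  move=> sub; have [p [r [e s1 s2]]] := @subseq_split _ [:: a; x] [:: b] _ sub.
  rewrite sub1seq in s2; case/splitPr: s2 e => r1 r2; rewrite catA => e.
  rewrite e in ab; have [_ ar] := sandwich_split ab.
  apply: (sandwich_subseq xa); rewrite e -catA.
  rewrite -[[:: a; x; a]]/([:: a; x] ++ [:: a]); apply: cat_subseq => //.
  by rewrite sub1seq mem_cat inE ar !orbT.
move=> sub; have [p [r [e s1 s2]]] := @subseq_split _ [:: a] [:: x; b] _ sub.
rewrite sub1seq in s1; case/splitPr: s1 e => p1 p2; rewrite -catA /= => e.
rewrite e in ba; have [bp _] := sandwich_split ba.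
apply: (sandwich_subseq xb); rewrite e.
rewrite -[[:: b; x; b]]/([:: b] ++ [:: x; b]); apply: cat_subseq.
  by rewrite sub1seq.
by rewrite -cat_cons; apply: subseq_trans s2 (suffix_subseq _ _).
Qed.

Lemma filter_pred2_sorted x y (w : word) : x != y -> ~ subseq [:: x; y] w ->
  filter (pred2 x y) w = nseq (count_mem y w) y ++ nseq (count_mem x w) x.
Proof.
move=> xy; elim: w => //= z w IHw sub.
case: (z =P x) sub => [->|zx] /=.
  rewrite eqxx sub1seq => /negP yw.
  rewrite filter_pred2_nseq //; have ->: count_mem y w = 0 by apply/count_memPn.
  by rewrite (negbTE xy).
move=> sub; case: (z =P y) sub => [->|zy] sub /=.
  rewrite IHw // => s; apply: sub; case: eqP => // _; move: s => /mem_subseq/(_ y).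
  by rewrite sub1seq !inE eqxx orbT => ->.
apply: IHw => s; apply: sub; case: eqP => // e; move: s => /mem_subseq/(_ y).
by rewrite sub1seq !inE eqxx orbT => ->.
Qed.

(** Of [x] and [y], only [x] occurs in [p]. If no [y] followed an [x] in [r], then [r] would
    contribute a block of [y] and then a block of [x], so [w] would restrict to a sandwich. *)
Lemma subseq_after_first x a y p r : let w := p ++ a :: r in
  sandwich x a w -> ~ sandwich x y w -> a \notin p -> y \notin p ->
  y != a -> x != y -> 1 < count_mem y w -> subseq [:: x; y] r.
Proof.
move=> w xa nxy ap yp ya xy cy; have [xp xr] := sandwich_split xa.
apply/negPn/negP => /negP sub; apply: nxy.
exists (count_mem x p), (count_mem y r), (count_mem x r).
move: cy; rewrite /w count_cat /= [a == y]eq_sym (negbTE ya).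
rewrite (_ : count_mem y p = 0); last by apply/count_memPn.
split=> //; rewrite -?has_count ?has_pred1 //.
rewrite /w filter_cat filter_pred2_nseq //.
case: xa => _ [_ [_ [/negbTE xa _ _ _ _]]].
by rewrite /= eq_sym xa eq_sym (negbTE ya) filter_pred2_sorted.
Qed.

(** Of two suffixes of one word, one is a suffix of the other. *)
Lemma suffix_conflict x y (p1 r1 p2 r2 : word) : p1 ++ r1 = p2 ++ r2 ->
  x \in r1 -> x \notin r2 -> y \in r2 -> y \notin r1 -> False.
Proof.
move=> e xr1 xr2 yr2 yr1.
have d1: r1 = drop (size p1) (p1 ++ r1) by rewrite drop_size_cat.
have d2: r2 = drop (size p2) (p1 ++ r1) by rewrite e drop_size_cat.
have [le|lt] := leqP (size p1) (size p2).
  move: yr2; rewrite d2 -(subnK le) -drop_drop -d1 => /mem_drop.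
  by rewrite (negbTE yr1).
move: xr1; rewrite d1 -(subnK (ltnW lt)) -drop_drop -d2 => /mem_drop.
by rewrite (negbTE xr2).
Qed.

(* x is the outermost letter of a nest x .. z .. z .. x, and a, a' are inner letters. *)
Definition nested x a a' w :=
  [/\ sandwich x a w, sandwich x a' w &
      [\/ a = a', sandwich a a' w | sandwich a' a w]].
(* If a comes before b, then x also begins before b; as {x,b} is not a sandwich,
   some b follows the second group of x, hence follows every a'. Symmetrically
   some a' follows every b. *)
Lemma first_occurrences_exclusive x y a a' b b' w :
  nested x a a' w -> nested y b b' w ->
  ~ sandwich x b w -> ~ sandwich y a' w ->
  x != b -> y != a' -> a != b -> a' != b' ->
  index a w < index b w -> index b' w < index a' w -> False.
Proof.
move=> [xa xa' aa'] [yb yb' bb'] nxb nya' neq1 neq2 neq3 neq4 lt1 lt2.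
have aux x0 c d : sandwich x0 c w -> ~ sandwich x0 d w -> x0 != d -> c != d ->
    1 < count_mem d w -> index c w < index d w ->
    exists q r, [/\ w = q ++ x0 :: r, c \in q & d \in r].
  move=> s ns n1 n2 c2 lt; have [p [r [e cp]]] := index_split (sandwich_mem s).2.
  have dp: d \notin p.
    by move: lt; rewrite e index_lt_cat_notin // => /andP[].
  rewrite e in s ns c2; have := subseq_after_first s ns cp dp _ n1 c2.
  rewrite eq_sym => /(_ n2) /(@subseq_split _ [:: x0] [:: d]) [r1 [r2 [e2]]].
  rewrite !sub1seq => x0r1 dr2; case/splitPr: x0r1 e2 => r3 r4 e2.
  exists (p ++ c :: r3), (r4 ++ r2).
  by rewrite e e2 !mem_cat inE eqxx dr2 !orbT -!catA.
have [q1 [r1 [e1 aq1 br1]]] := aux _ _ _ xa nxb neq1 neq3 (sandwich_count yb) lt1.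
have n4: b' != a' by rewrite eq_sym.
have [q2 [r2 [e2 bq2 ar2]]] := aux _ _ _ yb' nya' neq2 n4 (sandwich_count xa') lt2.
have aux2 z c d q r : w = q ++ z :: r -> c \in q -> ~ subseq [:: c; z; d] w -> d \notin r.
  move=> f cq ns; apply/negP => dr; apply: ns; rewrite f.
  rewrite -[[:: c; z; d]]/([:: c] ++ [:: z; d]); apply: cat_subseq.
    by rewrite sub1seq.
  by rewrite /= eqxx sub1seq.
have a'r1: a' \notin r1 := aux2 _ _ _ _ _ e1 aq1 (sandwich_subseq3 xa xa' aa').
have ns2: ~ subseq [:: b'; y; b] w.
  by apply: (sandwich_subseq3 yb' yb); case: bb' => [->|s|s]; [apply: Or31|apply: Or33|apply: Or32].
have br2: b \notin r2 := aux2 _ _ _ _ _ e2 bq2 ns2.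
(* The suffix [r1] contains [b] but not [a'], and [r2] contains [a'] but not [b]. *)
by apply: (@suffix_conflict b a' (rcons q1 x) r1 (rcons q2 y) r2); rewrite // !cat_rcons -e1.
Qed.

(** One copy of [m] contains [x y] or [y x] as a subsequence; the other copy supplies the missing
    outer [y] of the forbidden [y x y]. *)
Lemma sandwich_repeat x y p m q r : sandwich x y (p ++ m ++ q ++ m ++ r) ->
  x \in m -> y \in m -> False.
Proof.
move=> s xm ym; have xy: x != y by case: s => ? [? [? []]].
apply: (sandwich_subseq s); apply: subseq_trans (suffix_subseq _ _).
have -> : m ++ q ++ m ++ r = (m ++ q ++ m) ++ r by rewrite -!catA.
apply: subseq_trans (prefix_subseq _ _).
case/orP: (subseq_pair xm ym xy) => sub.
  rewrite -[[:: y; x; y]]/([:: y] ++ [:: x; y]) cat_subseq ?sub1seq //.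
  exact: subseq_trans sub (suffix_subseq _ _).
rewrite -[[:: y; x; y]]/([:: y; x] ++ [:: y]) cat_subseq // sub1seq.
by rewrite mem_cat ym orbT.
Qed.

(** * Identities of a monoid under substitution, deletion and derivation *)

Lemma eval_cat (S : monoid) (f : nat -> S) (u v : word) :
  eval f (u ++ v) = Defs.mul (eval f u) (eval f v).
Proof. by elim: u => /= [|x u ->]; rewrite ?Defs.mul1 ?Defs.mulA. Qed.

Lemma eval_subst (S : monoid) (f : nat -> S) (sigma : nat -> word) (u : word) :
  eval f (subst sigma u) = eval (fun x => eval f (sigma x)) u.
Proof. by rewrite /subst; elim: u => //= x u IHu; rewrite eval_cat IHu. Qed.

Lemma satisfies_subst (S : monoid) sigma a b u v : satisfies S u v ->
  satisfies S (a ++ subst sigma u ++ b) (a ++ subst sigma v ++ b).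
Proof. by move=> uv f; rewrite !eval_cat !eval_subst uv. Qed.

(** Deleting letters amounts to evaluating them at the identity element. *)
Lemma satisfies_filter (S : monoid) (P : pred nat) u v : satisfies S u v ->
  satisfies S (filter P u) (filter P v).
Proof.
move=> uv f; pose g z := if P z then f z else Defs.one S.
have evalP w : eval f (filter P w) = eval g w.
  by elim: w => //= z w IHw; rewrite {1}/g; case: ifP => //= _; rewrite IHw ?Defs.mul1.
by rewrite !evalP.
Qed.

Lemma satisfies_derivable (S : monoid) Sigma u v :
  (forall p, p \in Sigma -> satisfies S p.1 p.2) ->
  derivable Sigma u v -> satisfies S u v.
Proof.
move=> sat; elim=> {u v} [u|u v _ uv|u v w _ uv _ vw|s t sigma a b st _] f //.
  by rewrite uv vw.
by apply: satisfies_subst (sat _ st) f.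
Qed.

(** * Consequences of (ii), here [first_occurrences_rigid], and of (iv), here [sandwiches_rigid] *)

Definition first_occurrences_rigid (S : monoid) : Prop :=
  forall (m c : nat) (x t : nat) (v : word), 0 < m + c -> x != t -> v != [::] ->
  satisfies S (nseq m x ++ t :: nseq c x) v ->
  stable (nseq m x ++ t :: nseq c x) v [:: (x, 1); (t, 1)].

Definition sandwiches_rigid (S : monoid) : Prop :=
  forall (m c d : nat) (x y : nat) (w : word), 0 < m -> 0 < c -> 1 < d -> x != y ->
  w != [::] -> satisfies S (nseq m x ++ nseq d y ++ nseq c x) w ->
  exists i j k : nat, [/\ 0 < i, 0 < k, 1 < j & w = nseq i x ++ nseq j y ++ nseq k x].

(** Translates stability, stated through [pos], into comparisons of [index]. *)
Lemma pos_first x w : x \in w -> pos w (x, 1) = index x w.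
Proof.
move=> xw; have [p [r [e xp]]] := index_split xw.
have iw: index x w = size p by rewrite e index_pivot.
have f: find (preim (nth 0 w) (pred1 x)) (iota 0 (size w)) = size p.
  by rewrite -find_map -/(mkseq _ _) mkseq_nth.
rewrite iw /pos /=; set P := (fun k => _); have lt: size p < size w.
  by rewrite e size_cat /= addnS ltnS leq_addr.
have Pp: P (size p).
  rewrite /P e nth_cat ltnn subnn /= eqxx /= -cat_rcons take_size_cat ?size_rcons //.
  by rewrite -cats1 count_cat /= eqxx (_ : count_mem x p = 0) //; apply/count_memPn.
case: findP => [/hasPn no|i i_lt Pi before].
  by move: (no (size p)); rewrite mem_iota add0n lt Pp => /(_ isT).
rewrite size_iota in i_lt; move: Pi => /(_ 0); rewrite nth_iota // add0n => Pi.
have [lti|gti|//] := ltngtP i (size p).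
  move: lti; rewrite -f => /(before_find 0) /=.
  by rewrite nth_iota // add0n; case/andP: Pi => ->.
by move: (before 0 _ gti); rewrite nth_iota // add0n Pp.
Qed.

(** If [z] occurred on one side only, deleting all other letters would equate a positive power of
    [z] with the empty word. Appending a second variable, [z.+1], gives an identity whose right side
    lacks [z], against (ii). *)
Lemma rigid_mem S u v : first_occurrences_rigid S -> satisfies S u v -> u =i v.
Proof.
move=> rig uv; suff half u' v' : satisfies S u' v' -> {subset v' <= u'}.
  have vu: satisfies S v u by move=> f; rewrite uv.
  by move=> z; apply/idP/idP; apply: half.
move=> uv' z zv; apply/negPn/negP => zu.
have fz w : filter (pred1 z) w = nseq (count_mem z w) z.
  by rewrite -size_filter; apply/all_pred1P/filter_all.
have := satisfies_filter (pred1 z) uv'; rewrite !fz (count_memPn zu) => sat.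
have cz : 0 < count_mem z v' by rewrite -has_count has_pred1.
have := @rig (count_mem z v') 0 z z.+1 [:: z.+1]; rewrite addn0 => /(_ cz).
rewrite neq_ltn ltnSn => /(_ isT isT); case.
  by move=> f; rewrite eval_cat -sat /= Defs.mul1.
move=> /(_ (z, 1)); rewrite inE eqxx => /(_ isT) /andP[_].
by rewrite /is_occ /occ /= (gtn_eqF (ltnSn z)).
Qed.

(** As [t] is linear in [u], restricting the identity to [z] and [t] gives a left side of the form
    required by (ii); restriction preserves the order of first occurrences. *)
Lemma rigid_first S u v z t : first_occurrences_rigid S -> satisfies S u v ->
  count_mem t u = 1 -> (index z u < index t u) = (index z v < index t v).
Proof.
move=> rig uv tu; have uv_mem := rigid_mem rig uv.
have [->|zt] := eqVneq z t; first by rewrite !ltnn.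
have t_u: t \in u by rewrite -has_pred1 has_count tu.
have [zu|zu] := boolP (z \in u); last first.
  by rewrite !ltnNge (memNindex zu) index_size (memNindex (_ : z \notin v)) ?index_size -?uv_mem.
have [p [r [e tp tr]]] := count_eq1 tu.
have ef : filter (pred2 z t) u = nseq (count_mem z p) z ++ t :: nseq (count_mem z r) z.
  by rewrite e filter_cat /= eqxx orbT !filter_pred2_nseq.
have := satisfies_filter (pred2 z t) uv; rewrite ef => sat.
have tfv: t \in filter (pred2 z t) v by rewrite mem_filter /= eqxx orbT -uv_mem.
have zfv: z \in filter (pred2 z t) v by rewrite mem_filter /= eqxx -uv_mem.
have tfu: t \in filter (pred2 z t) u by rewrite mem_filter /= eqxx orbT.
have zfu: z \in filter (pred2 z t) u by rewrite mem_filter /= eqxx.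
case: (rig _ _ _ _ _ _ zt _ sat).
- move: zu; rewrite e mem_cat inE (negbTE zt) /=.
  by rewrite -!has_pred1 !has_count addn_gt0.
- by apply: contraTneq tfv => ->.
move=> _ /(_ (z, 1) (t, 1)); rewrite -ef !pos_first // !index_lt_filter /= ?eqxx ?orbT //.
by apply; rewrite !inE eqxx ?orbT.
Qed.

Lemma mem_subst sigma u v : u =i v -> subst sigma u =i subst sigma v.
Proof.
move=> uv z; apply/flatten_mapP/flatten_mapP => -[x xu zx]; exists x => //.
  by rewrite -uv.
by rewrite uv.
Qed.

Lemma subst_cat sigma u v : subst sigma (u ++ v) = subst sigma u ++ subst sigma v.
Proof. by rewrite /subst map_cat flatten_cat. Qed.

Lemma subst_cons sigma z u : subst sigma (z :: u) = sigma z ++ subst sigma u.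
Proof. by []. Qed.

(** By [rigid_first], the same letters precede the first [t] in [u] and in [v]. Hence on both sides
    [x] first occurs in that copy of [sigma t], after images with the same letters, and the
    comparison with [y] is settled no later than there. *)
Lemma rigid_subst_first S u v sigma (a b : word) x y p t r :
  first_occurrences_rigid S -> satisfies S u v -> count_mem t u = 1 ->
  u = p ++ t :: r -> x \notin a -> x \notin subst sigma p -> x \in sigma t ->
  (index x (a ++ subst sigma u ++ b) < index y (a ++ subst sigma u ++ b)) =
  (index x (a ++ subst sigma v ++ b) < index y (a ++ subst sigma v ++ b)).
Proof.
move=> rig uv ct eu xa xp xt; have uv_mem := rigid_mem rig uv.
have tv: t \in v by rewrite -uv_mem eu mem_cat inE eqxx orbT.
have [p' [r' [ev tp']]] := index_split tv.
have tp: t \notin p.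
  apply/negP => tp; have : subseq [:: t; t] u.
    rewrite eu -[[:: t; t]]/([:: t] ++ [:: t]) cat_subseq ?sub1seq // mem_head.
    by [].
  by move/(leq_count_subseq (pred1 t)); rewrite ct /= eqxx.
have pp: p =i p'.
  move=> z; have := rigid_first z rig uv ct; rewrite eu ev.
  rewrite !index_cat /= eqxx (negbTE tp) (negbTE tp') !addn0.
  have aux (q : word) s : ((if z \in q then index z q else size q + s) < size q) = (z \in q).
    by case: ifP => [zq|_]; [rewrite index_mem | rewrite ltnNge leq_addr].
  by rewrite !aux.
have aux q s : p =i q -> index x (a ++ subst sigma (q ++ t :: s) ++ b) <
    index y (a ++ subst sigma (q ++ t :: s) ++ b) =
    [&& y \notin a, y \notin subst sigma p & index x (sigma t) < index y (sigma t)].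
  move=> pq; rewrite subst_cat subst_cons -!catA index_lt_cat_notin //.
  rewrite index_lt_cat_notin; last by rewrite -(mem_subst sigma pq).
  by rewrite -(mem_subst sigma pq) index_lt_cat.
by rewrite eu ev !aux.
Qed.

(* By pigeonhole two letters of A occur first inside the image of the same variable t;
   t is linear in u, since a second copy of its image would break their sandwich. *)
Lemma rigid_first_stable S u v sigma a b (A : seq nat) :
  let U := a ++ subst sigma u ++ b in let V := a ++ subst sigma v ++ b in
  first_occurrences_rigid S -> satisfies S u v ->
  uniq A -> size u < size A -> {subset A <= U} ->
  {in A &, forall x x', x != x' -> sandwich x x' U \/ sandwich x' x U} ->
  exists2 x, x \in A & forall y, (index x U < index y U) = (index x V < index y V).
Proof.
move=> U V rig uv uA ltA AU sand; have uv_mem := rigid_mem rig uv.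
case: (boolP (all (fun x => (x \notin a) && (x \in subst sigma u)) A)); last first.
  (* A letter occurring in [a], or absent from the image of [u], serves at once: [a] and [b] are
     common to both sides, and the images of [u] and [v] have the same letters. *)
  case/allPn => x xA; rewrite negb_and negbK => xcase; exists x => // y.
  have [xa|xa] := boolP (x \in a); first by rewrite /U /V !index_lt_cat.
  rewrite (negbTE xa) /= in xcase.
  rewrite /U /V index_lt_cat_notin // [in RHS]index_lt_cat_notin //.
  rewrite index_lt_cat_notin // [in RHS]index_lt_cat_notin //.
    by rewrite (mem_subst sigma uv_mem).
  by rewrite -(mem_subst sigma uv_mem).
(* For [x] in [A], [h x] is the position in [u] of the variable whose image contains the first
   [x]. *)
move=> /allP allA; pose h x := find (fun z => x \in sigma z) u.
have hP x : x \in A -> h x < size u /\ x \in sigma (nth 0 u (h x)) /\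
    x \notin subst sigma (take (h x) u).
  move=> /allA /andP[_ /flatten_mapP[z zu xz]].
  have hasx: has (fun z => x \in sigma z) u by apply/hasP; exists z.
  rewrite -has_find; split=> //; split; first exact: nth_find hasx.
  apply/negP => /flatten_mapP [z' z'u xz'].
  have := find_ltn; move: z'u.
  rewrite in_take_leq ?find_size // => lt; have := before_find 0 lt.
  rewrite nth_index ?xz' // -index_mem (leq_trans lt) //; exact: find_size.
have /uniqPn : ~~ uniq (map h A).
  apply: contraL ltA => un; rewrite -leqNgt -(size_map h) -(size_iota 0 (size u)).
  apply: uniq_leq_size un _ => _ /mapP[x xA ->].
  by rewrite mem_iota add0n (hP x xA).1.
move=> /(_ 0) [i [j [ij]]]; rewrite size_map => jA.
have iA := ltn_trans ij jA.
rewrite !(nth_map 0) //; set x := nth 0 A i; set x' := nth 0 A j => hh.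
have xA: x \in A by apply: mem_nth.
have x'A: x' \in A by apply: mem_nth.
have xx': x != x' by rewrite nth_uniq // (ltn_eqF ij).
have [hx [xt xp]] := hP x xA; have [_ [x't _]] := hP x' x'A; rewrite -hh in x't.
set t := nth 0 u (h x) in xt x't.
have eu : u = take (h x) u ++ t :: drop (h x).+1 u.
  by rewrite -drop_nth // cat_take_drop.
exists x => // y0; apply: (rigid_subst_first _ _ rig uv _ eu _ xp xt) => //; last first.
  by have /andP[] := allA x xA.
have tp: t \notin take (h x) u.
  by apply: contra xp => tp; apply/flatten_mapP; exists t.
rewrite {1}eu count_cat /= eqxx (count_memPn tp).
case: (boolP (t \in drop (h x).+1 u)) => [tr|/count_memPn -> //].
case/splitPr: tr eu => r1 r2 eu.
have eU : U = (a ++ subst sigma (take (h x) u)) ++ sigma t ++ subst sigma r1 ++ sigma t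
    ++ (subst sigma r2 ++ b).
  by rewrite /U {1}eu !(subst_cat, subst_cons) -!catA.
case: (sand x x' xA x'A xx'); rewrite eU => s.
  by case: (sandwich_repeat s xt x't).
by case: (sandwich_repeat s x't xt).
Qed.

Lemma rigid_sandwich S u w x y : first_occurrences_rigid S -> sandwiches_rigid S ->
  satisfies S u w -> sandwich x y u -> sandwich x y w.
Proof.
move=> rig1 rig2 uw sand; have [a [b [c [xy a0 b1 c0 e]]]] := sand.
have := satisfies_filter (pred2 x y) uw; rewrite e => sat.
have w0: filter (pred2 x y) w != [::].
  rewrite -has_filter; apply/hasP; exists x; last by rewrite /= eqxx.
  by rewrite -(rigid_mem rig1 uw) (sandwich_mem sand).1.
have [i [j [k [i0 k0 j1 ew]]]] := rig2 _ _ _ _ _ _ a0 c0 b1 xy w0 sat.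
by exists i, j, k.
Qed.

(** * Sandwiches in the left side of (i) *)

Lemma filter_iota (P : pred nat) m n s : sorted ltn s ->
  (forall z, (z \in s) = P z && (m <= z < m + n)) -> filter P (iota m n) = s.
Proof.
move=> ss sP; apply: (irr_sorted_eq ltn_trans ltnn) => //.
  exact: sorted_filter ltn_trans _ _ (iota_ltn_sorted _ _).
by move=> z; rewrite mem_filter mem_iota sP.
Qed.

(** The restriction is [x x' x' x]: one increasing and one reversed copy. *)
Lemma sandwich_lhs_xs n x x' : 0 < x -> x < x' -> x' <= n -> sandwich x x' (lhs_i n).
Proof.
move=> x0 xx' x'n; exists 1, 2, 1; split=> //; first by rewrite neq_ltn xx'.
rewrite /lhs_i !filter_cat !filter_rev /xs /ys.
rewrite (@filter_iota _ 1 n [:: x; x']) ?(@filter_iota _ n.+1 n [::]) //=.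
- by move=> z; rewrite in_nil; lia.
- by rewrite xx'.
by move=> z; rewrite !inE; lia.
Qed.

Lemma sandwich_lhs_ys n y y' : n < y -> y < y' -> y' <= n + n -> sandwich y y' (lhs_i n).
Proof.
move=> y0 yy' y'n; exists 1, 2, 1; split=> //; first by rewrite neq_ltn yy'.
rewrite /lhs_i !filter_cat !filter_rev /xs /ys.
rewrite (@filter_iota _ n.+1 n [:: y; y']) ?(@filter_iota _ 1 n [::]) //=.
- by move=> z; rewrite in_nil; lia.
- by rewrite yy'.
by move=> z; rewrite !inE; lia.
Qed.

Lemma not_sandwich_lhs n x y : 0 < x <= n -> n < y <= n + n ->
  ~ sandwich x y (lhs_i n) /\ ~ sandwich y x (lhs_i n).
Proof.
move=> xn yn.
have e: filter (pred2 x y) (lhs_i n) = [:: x; y; x; y].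
  rewrite /lhs_i !filter_cat !filter_rev /xs /ys.
  rewrite (@filter_iota _ n.+1 n [:: y]) ?(@filter_iota _ 1 n [:: x]) //=;
  by move=> z; rewrite !inE; lia.
have sub s : subseq s [:: x; y; x; y] -> subseq s (lhs_i n).
  by rewrite -e => /subseq_trans; apply; apply: filter_subseq.
split=> /sandwich_subseq; apply; apply: sub.
  by apply: (@subseq_trans _ [:: y; x; y]); rewrite ?subseq_refl // subseq_cons.
by rewrite (prefix_subseq [:: x; y; x] [:: y]).
Qed.

(** * The invariant of derivations; indices start at 2 because x_1 and y_1 ([1] and [n.+1]) serve as
    outer letters of nests *)

Definition some_x_before_some_y n w : Prop :=
  exists i j, [/\ 1 < i <= n, n.+1 < j <= n + n & index i w < index j w].

(** Among x_2, ..., x_n, [rigid_first_stable] finds some [x] whose comparisons survive the step. By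
    exclusivity this [x] starts before y [j] already in the first word, hence also in the second. *)
Lemma some_x_before_some_y_step S n u v sigma a b :
  first_occurrences_rigid S -> sandwiches_rigid S -> satisfies S u v -> size u < n.-1 ->
  satisfies S (lhs_i n) (a ++ subst sigma u ++ b) ->
  some_x_before_some_y n (a ++ subst sigma u ++ b) ->
  some_x_before_some_y n (a ++ subst sigma v ++ b).
Proof.
move=> rig1 rig2 uv un lhsU [i [j [i_n j_n ij]]].
have sandU x y := rigid_sandwich (x := x) (y := y) rig1 rig2 lhsU.
have nsandU x y : 0 < x <= n -> n < y <= n + n ->
    ~ sandwich x y (a ++ subst sigma u ++ b) /\ ~ sandwich y x (a ++ subst sigma u ++ b).
  (* A forbidden sandwich here would be carried back to the left side of (i). *)
  have Ulhs: satisfies S (a ++ subst sigma u ++ b) (lhs_i n) by move=> f; rewrite lhsU.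
  move=> xn yn; have [nxy nyx] := not_sandwich_lhs xn yn.
  by split=> /(rigid_sandwich rig1 rig2 Ulhs).
have xsU x x' : 0 < x -> x < x' -> x' <= n -> sandwich x x' (a ++ subst sigma u ++ b).
  by move=> *; apply/sandU/sandwich_lhs_xs.
have xsU2 x x' : 0 < x <= n -> 0 < x' <= n -> x != x' ->
    sandwich x x' (a ++ subst sigma u ++ b) \/ sandwich x' x (a ++ subst sigma u ++ b).
  by move=> xn x'n; case: ltngtP => // lt _; [left|right]; apply: xsU; lia.
have [||||x] := @rigid_first_stable S u v sigma a b (iota 2 n.-1) rig1 uv.
- exact: iota_uniq.
- by rewrite size_iota.
- move=> x; rewrite mem_iota => xn; apply: (sandwich_mem (x := 1) _).2; apply: xsU; lia.
- move=> x x'; rewrite !mem_iota => xn x'n; apply: xsU2; lia.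
rewrite mem_iota => xn stab; exists x, j; split=> //; first by lia.
rewrite -stab ltnNge; apply/negP => le.
have jU: j \in a ++ subst sigma u ++ b.
  by apply: (sandwich_mem (x := n.+1) _).2; apply: sandU; apply: sandwich_lhs_ys; lia.
have lt: index j (a ++ subst sigma u ++ b) < index x (a ++ subst sigma u ++ b).
  rewrite ltn_neqAle le andbT; apply/negP => /eqP e.
  have xj: x = j.
    rewrite -(nth_index 0 jU) e nth_index // -index_mem -e index_mem //.
  lia.
(* Letter [1] encloses [i] and [x], and [n.+1] encloses [j]; yet [i] would start before [j], and [j]
   before [x]. *)
apply: (@first_occurrences_exclusive 1 n.+1 i x j j _ _ _ _ _ _ _ _ _ ij lt); try lia.
- split; [apply: xsU; lia | apply: xsU; lia |].
  have [->|ix] := eqVneq i x; first by apply: Or31.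
  by case: (xsU2 i x) => // [||s|s]; [lia|lia|apply: Or32|apply: Or33].
- by split; [apply: sandU; apply: sandwich_lhs_ys; lia .. | apply: Or31].
- by apply: (nsandU 1 j _ _).1; lia.
by apply: (nsandU x n.+1 _ _).2; lia.
Qed.

Theorem theorem2p7 (S : monoid) :
  (exists N : nat, forall n : nat, N <= n -> satisfies S (lhs_i n) (rhs_i n)) ->
  (forall (m c : nat) (x t : nat) (v : word), 0 < m + c -> x != t -> v != [::] ->
     satisfies S (nseq m x ++ t :: nseq c x) v ->
     stable (nseq m x ++ t :: nseq c x) v [:: (x, 1); (t, 1)]) ->
  (forall (m c : nat) (x y : nat) (w : word), 1 < m -> 1 < c -> x != y -> w != [::] ->
     satisfies S (nseq m x ++ nseq c y) w ->
     exists i j : nat, [/\ 1 < i, 1 < j & w = nseq i x ++ nseq j y]) ->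
  (forall (m c d : nat) (x y : nat) (w : word), 0 < m -> 0 < c -> 1 < d -> x != y ->
     w != [::] ->
     satisfies S (nseq m x ++ nseq d y ++ nseq c x) w ->
     exists i j k : nat, [/\ 0 < i, 0 < k, 1 < j & w = nseq i x ++ nseq j y ++ nseq k x]) ->
  non_finitely_based S.
Proof.
move=> [N sat_i] rig1 _ rig2 [Sigma [sat complete]].
pose K := \max_(p <- Sigma) (size p.1 + size p.2).
have leK p : p \in Sigma -> size p.1 + size p.2 <= K.
  by move=> pS; rewrite /K (big_rem p) //= leq_maxl.
(* Now [n >= N], so (i) applies; [n.-1] exceeds the length of every side in [Sigma]; and [n >= 2],
   so x_2 and y_2 exist. *)
have [n nE] : exists n, n = N + K + 3 by exists (N + K + 3).
clearbody K.
have satS p : p \in Sigma -> satisfies S p.1 p.2 by move=> /sat[].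
(* The equivalence accommodates symmetry; equality in [S] with the left side of (i) keeps the
   sandwich structure available at every word of the derivation. *)
have invariant u v : derivable Sigma u v -> satisfies S (lhs_i n) u ->
    some_x_before_some_y n u <-> some_x_before_some_y n v.
  elim=> {u v} [u|u v uv IH lu|u v w uv IHuv _ IHvw lu|s t sigma a b st _ lu] //.
  - by apply: iff_sym; apply: IH => f; rewrite lu (satisfies_derivable satS uv).
  - rewrite IHuv //; apply: IHvw => f.
    by rewrite lu (satisfies_derivable satS uv).
  have := leK _ st; have /= sat_st := satS _ st => /= le.
  have nK: n.-1 = N + K + 2 by rewrite nE addnS.
  have sn: size s < n.-1 by lia.
  have tn: size t < n.-1 by lia.
  have lt: satisfies S (lhs_i n) (a ++ subst sigma t ++ b).
    by move=> f; rewrite lu; apply: satisfies_subst.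
  have sat_ts: satisfies S t s by move=> f; rewrite sat_st.
  by split; apply: (some_x_before_some_y_step rig1 rig2).
have sat_n: satisfies S (lhs_i n) (rhs_i n) by apply: sat_i; lia.
(* A derivation of (i) would carry the property from the left side, with witnesses x_2 and y_2, to
   the right side, where every y starts before every x. *)
have [] : some_x_before_some_y n (rhs_i n).
  apply/(invariant (lhs_i n)) => //; first by apply: complete; rewrite // nE addn3.
  exists 2, n.+2; split; [lia | lia |].
  rewrite /lhs_i index_lt_cat; last by rewrite /xs mem_iota; lia.
  by rewrite [X in _ < X]memNindex ?index_mem /xs mem_iota; lia.
move=> i [j [i_n j_n]].
rewrite /rhs_i index_lt_cat_notin; last by rewrite /ys mem_iota; lia.
by rewrite /ys mem_iota; lia.
Qed.
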